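(* Let $g\in\mathbb{R}[x,y]$ be of degree $d$ and let $\mathcal{C}=\{g=0\}\subset\mathbb{R}^2$ be in general position (as defined in the context). Let $(\{x_i\},\{y_{ij}\})$ be part of a data for $\mathcal{C}$, that is, a good partition together with its fibers, and let $g_y$ be the derivative of $g$ with respect to $y$. For each $(x_i,y_{ij})$ let $\delta_{ij}\in\{0,1\}$ be defined by $\delta_{ij}=1$ if and only if $g_y(x_i,y_{ij})\neq 0$. Then, from $(\{x_i\},\{y_{ij}\})$ and the values $\delta_{ij}$, it is possible to complete $(\{x_i\},\{y_{ij}\})$ to a data $(\{x_i\},\{y_{ij}\},L,R)$ for $\mathcal{C}$ by making $\mathcal{O}(d^3)$ extra additions of integers.
   Context: Let $\pi:\mathcal{C}\to\mathbb{R}$, $\pi(x,y)=x$. General position means: $\mathcal{C}$ is generically smooth (singular at only finitely many points), $\pi$ has finite fibers, and any two distinct critical points of $\pi$ lie in different fibers of $\pi$. A point of $\mathcal{C}$ is a critical point of $\pi$ if $g_y$ vanishes there (the point is singular or has a vertical tangent line); other points of $\mathcal{C}$ are regular. A critical value is the image under $\pi$ of a critical point; all other real numbers are regular values. A good partition for $\mathcal{C}$ is a finite set $x_1<\dots<x_n$ of real numbers, $n\ge 2$, such that for every critical value $x$ of $\pi$ there is an $i$ with $x=x_i$ and $x_{i-1},x_{i+1}$ (which must exist) regular values. Write $\pi^{-1}(x_i)=\{y_{i1}<\dots<y_{ir_i}\}$, $0\le r_i\le d$ (points of the fiber are identified with their $y$-coordinates). Branches (standing convention, part of the setting): over each interval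 $(x_i,x_{i+1})$, $1\le i\le n-1$, the number of real roots of $g(x,-)$ is a constant $\rho_i$, the roots are given by continuous functions $\varphi_{i,1}<\dots<\varphi_{i,\rho_i}:(x_i,x_{i+1})\to\mathbb{R}$, and these extend continuously to $[x_i,x_{i+1}]$, with values at the endpoints in the fibers over $x_i$ and $x_{i+1}$. The number of half-branches to the right at $(x_i,y_{ij})$ is $\#\{k:\varphi_{i,k}(x_i)=y_{ij}\}$, and the number of half-branches to the left is $\#\{k:\varphi_{i-1,k}(x_i)=y_{ij}\}$. For $i=1$ (left) and $i=n$ (right) the branches over a sufficiently small interval to the left of $x_1$, respectively to the right of $x_n$, are used; since $x_1$ and $x_n$ are regular values these numbers equal $1$. A data for $\mathcal{C}$ is a tuple $(\{x_i\}_{i=1}^n,\{y_{ij}\},L,R)$ where $\{x_i\}$ is a good partition, $\{y_{ij}\}$ are the points of the fibers $\pi^{-1}(x_i)=\{y_{i1}<\dots<y_{ir_i}\}$, $1\le i\le n$, and $L,R\in\mathbb{N}_0^{n\times d}$ are such that $L_{ij}$ (resp. $R_{ij}$) is the number of half-branches to the left (resp. right) at $(x_i,y_{ij})$ for $1\le j\le r_i$, and $L_{ij}=R_{ij}=0$ for $j>r_i$. The cost counts only additions and subtractions of integers (initializing matrix entries to $0$ or $1$ is not counted). *)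

(* Defs.v *)
From HB Require Import structures.
From mathcomp Require Import all_boot all_order all_algebra.
From mathcomp Require Import all_classical all_reals all_analysis.

Set Implicit Arguments.
Unset Strict Implicit.
Unset Printing Implicit Defensive.

Import Order.TTheory GRing.Theory Num.Theory.
Import numFieldNormedType.Exports.

Local Open Scope classical_set_scope.
Local Open Scope ring_scope.

Section Curve.
Variable R : realType.

(* R[x,y] is represented as R[x][y]: the outer variable of g is y and its
   coefficients are polynomials in x, so g^`() is the y-derivative. *)
Implicit Type g : {poly {poly R}}.

Definition ev g (x y : R) : R := (g.[y%:P]).[x].

Definition dx g : {poly {poly R}} := map_poly (@deriv R) g.
Definition dy g : {poly {poly R}} := g^`().

(* Total degree in (x, y), with value 0 on the zero polynomial. *)
Definition tdeg g : nat := \max_(j < size g | (g`_j != 0)%R) (j + (size (g`_j)%R).-1)%N.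

Definition curve g : set (R * R) := [set p | ev g p.1 p.2 = 0].

Definition singular g : set (R * R) :=
  [set p | [/\ curve g p, ev (dx g) p.1 p.2 = 0 & ev (dy g) p.1 p.2 = 0]].

Definition critical g : set (R * R) :=
  [set p | curve g p /\ ev (dy g) p.1 p.2 = 0].

Definition critical_value g : set R := [set p.1 | p in critical g].

Definition regular_value g : set R := ~` critical_value g.

Definition general_position g : Prop :=
  [/\ finite_set (singular g),
      forall x : R, finite_set (curve g `&` [set p | p.1 = x]) &
      forall p q : R * R, critical g p -> critical g q -> p <> q -> p.1 <> q.1].

(* Indices are 0-based: the mathematical x_i is xs`_(i-1). *)
Definition good_partition g (xs : seq R) : Prop :=
  [/\ sorted <%R xs, (2 <= size xs)%N &
      forall x : R, critical_value g x ->
        exists i : nat, [/\ (0 < i)%N, (i.+1 < size xs)%N, x = xs`_i,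
          regular_value g xs`_i.-1 & regular_value g xs`_i.+1]].

Definition fibers g (xs : seq R) (ys : seq (seq R)) : Prop :=
  size ys = size xs /\
  forall i : nat, (i < size xs)%N ->
    sorted <%R (nth [::] ys i) /\
    forall y : R, y \in nth [::] ys i <-> curve g (xs`_i, y).

Definition branches g (a b : R) (rho : nat) (phi : 'I_rho -> R -> R) : Prop :=
  [/\ forall k : 'I_rho, {in `]a, b[, continuous (phi k)},
      forall x : R, x \in `]a, b[ ->
        forall k l : 'I_rho, (k < l)%N -> phi k x < phi l x &
      forall x : R, x \in `]a, b[ ->
        forall y : R, curve g (x, y) <-> exists k : 'I_rho, phi k x = y].

(* phi i k stands for the continuous extension of the k-th branch over
   ]xs`_i, xs`_i.+1[ to the closed interval; its values outside of that
   interval are irrelevant. *)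
Definition branch_system g (xs : seq R) (rho : nat -> nat)
    (phi : forall i : nat, 'I_(rho i) -> R -> R) : Prop :=
  forall i : nat, (i.+1 < size xs)%N ->
    branches g xs`_i xs`_i.+1 (phi i) /\
    forall k : 'I_(rho i),
      [/\ {within `[xs`_i, xs`_i.+1], continuous (phi i k)},
          curve g (xs`_i, phi i k xs`_i) &
          curve g (xs`_i.+1, phi i k xs`_i.+1)].

(* m branches of a small interval to the left (resp. right) of x end at (x, y).
   Limits are used since other branches may be unbounded near x. *)
Definition end_half_left g (x y : R) (m : nat) : Prop :=
  exists (e : R) (rho : nat) (phi : 'I_rho -> R -> R),
    [/\ 0 < e, branches g (x - e) x phi &
        m = #|[pred k : 'I_rho | `[< phi k t @[t --> x^'-] --> y >]]| ].

Definition end_half_right g (x y : R) (m : nat) : Prop :=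
  exists (e : R) (rho : nat) (phi : 'I_rho -> R -> R),
    [/\ 0 < e, branches g x (x + e) phi &
        m = #|[pred k : 'I_rho | `[< phi k t @[t --> x^'+] --> y >]]| ].

Definition half_left g (xs : seq R) (rho : nat -> nat)
    (phi : forall i : nat, 'I_(rho i) -> R -> R) (i : nat) (y : R) (m : nat) :
    Prop :=
  if i is i'.+1 then m = #|[pred k : 'I_(rho i') | phi i' k xs`_i == y]|
  else end_half_left g xs`_i y m.

Definition half_right g (xs : seq R) (rho : nat -> nat)
    (phi : forall i : nat, 'I_(rho i) -> R -> R) (i : nat) (y : R) (m : nat) :
    Prop :=
  if (i.+1 < size xs)%N then m = #|[pred k : 'I_(rho i) | phi i k xs`_i == y]|
  else end_half_right g xs`_i y m.

Definition is_data g (rho : nat -> nat)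
    (phi : forall i : nat, 'I_(rho i) -> R -> R) (xs : seq R) (ys : seq (seq R))
    (ML MR : 'M[nat]_(size xs, tdeg g)) : Prop :=
  [/\ good_partition g xs, fibers g xs ys,
      forall i : 'I_(size xs), (size (nth [::] ys i) <= tdeg g)%N &
      forall (i : 'I_(size xs)) (j : 'I_(tdeg g)),
        let yi := nth [::] ys i in
        if (j < size yi)%N then
          half_left g xs phi i yi`_j (ML i j) /\
          half_right g xs phi i yi`_j (MR i j)
        else ML i j = 0%N /\ MR i j = 0%N].

End Curve.

Arguments is_data {R} g {rho} phi xs ys ML MR.

(* Programs filling two integer matrices. Integers can only be created as 0 or 1
   (free) or by an addition or subtraction (cost 1 each). Control (bounded
   iteration over the partition points and over the points of a fiber, tests on
   delta) is free, but it can neither observe the computed integers nor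
   turn an index into an integer. *)

Variant mat := MatL | MatR.

(* Row v + c of the partition, where v is the name of a loop variable. *)
Definition row_expr : Type := (nat * nat)%type.

(* The entry of a matrix in a given row, at the column held by a loop variable. *)
Record cell := Cell { cell_mat : mat; cell_row : row_expr; cell_col : nat }.

Inductive prog :=
| Skip
| Seq of prog & prog
| Init of cell & bool
| AddTo of cell & cell & cell
| SubTo of cell & cell & cell
| IfDelta of row_expr & nat & prog & prog
| ForRow of nat & prog
| ForFiber of nat & row_expr & prog.

Definition env := nat -> nat.
Definition memory := mat -> nat -> nat -> int.

Record state := State { entries : memory; cost : nat }.

Definition eval_row (e : env) (r : row_expr) : nat := (e r.1 + r.2)%N.

Definition bind_var (e : env) (v n : nat) : env :=
  fun w => if w == v then n else e w.

Definition read (e : env) (s : state) (c : cell) : int :=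
  entries s (cell_mat c) (eval_row e (cell_row c)) (e (cell_col c)).

Definition same_mat (a b : mat) : bool :=
  match a, b with MatL, MatL | MatR, MatR => true | _, _ => false end.

Definition write (e : env) (s : state) (c : cell) (z : int) : memory :=
  fun a i j =>
    if [&& same_mat a (cell_mat c), i == eval_row e (cell_row c)
         & j == e (cell_col c)]
    then z else entries s a i j.

Section Semantics.
Variables (R : realType) (xs : seq R) (ys : seq (seq R)).
Variable delta : nat -> nat -> bool.

Fixpoint exec (p : prog) (e : env) (s : state) {struct p} : state :=
  match p with
  | Skip => s
  | Seq p1 p2 => exec p2 e (exec p1 e s)
  | Init c b => State (write e s c (b : nat)%:Z) (cost s)
  | AddTo c a b => State (write e s c (read e s a + read e s b)) (cost s).+1
  | SubTo c a b => State (write e s c (read e s a - read e s b)) (cost s).+1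
  | IfDelta r w p1 p2 =>
      if delta (eval_row e r) (e w) then exec p1 e s else exec p2 e s
  | ForRow v q =>
      foldl (fun t i => exec q (bind_var e v i) t) s (iota 0 (size xs))
  | ForFiber w r q =>
      foldl (fun t j => exec q (bind_var e w j) t) s
        (iota 0 (size (nth [::] ys (eval_row e r))))
  end.

(* All matrix entries are initialized to 0. *)
Definition run (p : prog) : state :=
  exec p (fun=> 0%N) (State (fun _ _ _ => 0) 0).

End Semantics.

(* Main.v *)
(* At a regular point of the curve exactly one branch arrives from each side.
   By general position a critical fiber contains a single critical point, and
   the neighbouring partition points are regular values. So the number of
   branches between x_i and x_(i+1) is the number of points of a regular
   neighbouring fiber, and the number of half-branches at the critical point of
   a critical fiber is that number minus the number of regular points of the
   fiber: at most 4d additions per critical value.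

   There are at most 2 d^2 critical values. Write g = h u and g_y = h v with h a
   gcd. Critical points off h = 0 are common zeros of u and v, whose abscissas
   are roots of a nonzero resultant. As g has finitely many critical values,
   h = 0 has finitely many zeros; so h_y vanishes at all of them, since a simple
   root in y would persist for nearby x. Hence the zeros of h are critical
   points of h, and one concludes by induction on the degree in y, the bound
   2 deg_x deg_y being superadditive under products. *)
Require Import Defs.
From mathcomp Require Import all_boot all_order all_algebra.
From mathcomp Require Import all_classical all_reals all_analysis.
From mathcomp Require Import perm polyrcf zify ring lra.

Set Implicit Arguments.
Unset Strict Implicit.
Unset Printing Implicit Defensive.

Import Order.TTheory GRing.Theory Num.Theory.
Import numFieldNormedType.Exports.

Local Open Scope ring_scope.

(** * Gauss' lemma and coprime cofactors *)

Lemma irreducible_factor (F : fieldType) (c : {poly F}) :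
  (1 < size c)%N -> exists2 p : {poly F}, irreducible_poly p & p %| c.
Proof.
have [n le_n] := ubnP (size c); elim: n c le_n => // n IHn c le_n c1.
have [irr|nirr] := pselect (irreducible_poly c); first by exists c.
have [q [q1 qc nqc]] : exists q : {poly F}, [/\ size q != 1%N, q %| c & ~~ (q %= c)].
  apply: contrapT => none; apply: nirr; split => // q q1 qc.
  by apply: contrapT => nqc; apply: none; exists q; split => //; apply/negP.
have c0 : c != 0 by rewrite -size_poly_gt0; lia.
have q0 : q != 0 by apply: contraTneq qc => ->; rewrite dvd0p.
have q_gt1 : (1 < size q)%N by have := size_poly_gt0 q; rewrite q0; lia.
have ltqc : (size q < size c)%N.
  by rewrite ltn_neqAle dvdp_leq // andbT dvdp_size_eqp.
have [|p irr pq] := IHn q _ q_gt1; first by lia.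
by exists p => //; apply: dvdp_trans qc.
Qed.

Lemma irreducible_dvdpM (F : fieldType) (p a b : {poly F}) :
  irreducible_poly p -> p %| a * b -> (p %| a) || (p %| b).
Proof.
move=> irr pab; case: (boolP (p %| a)) => //= npa.
by rewrite -(Gauss_dvdpr _ (_ : coprimep p a)) // irreducible_poly_coprime.
Qed.

Lemma content_dvdP (F : fieldType) (p : {poly F}) (u : {poly {poly F}}) :
  (forall i, p %| u`_i) -> exists w, u = p *: w.
Proof.
move=> pu; exists (map_poly (fun a => a %/ p) u).
apply/polyP => i; rewrite coefZ coef_map_id0 ?div0p // mulrC.
by rewrite divpK.
Qed.

(** An irreducible of F[x] stays prime in F[x][y]: it divides the product of the two leading
    coefficients, hence one of them, and removing that leading term preserves the hypothesis on the
    product while lowering the total size. *)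
Lemma irreducible_content (F : fieldType) (p : {poly F}) (u v : {poly {poly F}}) :
  irreducible_poly p -> (forall i, p %| (u * v)`_i) ->
  (forall i, p %| u`_i) \/ (forall i, p %| v`_i).
Proof.
move=> irr; have [n le_n] := ubnP (size u + size v).
elim: n u v le_n => // n IHn u v le_n puv.
have [->|u0] := eqVneq u 0; first by left=> i; rewrite coef0 dvdp0.
have [->|v0] := eqVneq v 0; first by right=> i; rewrite coef0 dvdp0.
(* The factor [a] is the one whose leading coefficient [p] divides; by commutativity this serves for
   [u] as well as for [v]. *)
have wlog_step (a b : {poly {poly F}}) : a != 0 -> (size a + size b < n.+1)%N ->
    (forall i, p %| (a * b)`_i) -> p %| lead_coef a ->
    (forall i, p %| a`_i) \/ (forall i, p %| b`_i).
  move=> a0 le_ab pab pa.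
  pose a' := a - lead_coef a *: 'X^((size a).-1).
  have sz : (size a' < size a)%N.
    rewrite -[X in (_ < X)%N](prednK (_ : 0 < size a)%N) ?size_poly_gt0 //.
    rewrite ltnS; apply/leq_sizeP => j le_j; rewrite coefB coefZ coefXn.
    have [->|ne_j] := eqVneq j (size a).-1; first by rewrite mulr1 subrr.
    by rewrite mulr0 subr0 nth_default // -(prednK (_ : 0 < size a)%N) ?size_poly_gt0 //; lia.
  have pa' i : p %| (a' * b)`_i.
    rewrite mulrBl coefB dvdp_sub // -scalerAl coefZ.
    exact: dvdp_mulr.
  case: (IHn a' b _ pa') => [|pa'i|pb]; [by lia|left=> i|by right].
  have -> : a = a' + lead_coef a *: 'X^((size a).-1) by rewrite subrK.
  by rewrite coefD dvdp_add // coefZ dvdp_mulr.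
have : p %| lead_coef u * lead_coef v by rewrite -lead_coefM; apply: puv.
case/(irreducible_dvdpM irr)/orP => pl; first exact: wlog_step.
have [pv|pu] : (forall i, p %| v`_i) \/ (forall i, p %| u`_i).
- by apply: wlog_step; rewrite // 1?mulrC // addnC.
- by right.
- by left.
Qed.

(* Gauss' lemma: a common factor over the fraction field F(x) is a common
   factor in F[x][y]. *)
Lemma common_factor_scale (F : fieldType) (c : {poly F})
    (u v w u1 v1 : {poly {poly F}}) :
  c != 0 -> c *: u = w * u1 -> c *: v = w * v1 ->
  exists w' u' v' : {poly {poly F}}, [/\ size w' = size w, u = w' * u' & v = w' * v'].
Proof.
have [n le_n] := ubnP (size c).
elim: n c u v w u1 v1 le_n => // n IHn c u v w u1 v1 le_n c0 Eu Ev.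
case: (ltnP 1 (size c)) => c1; last first.
  (* A constant [c] is a unit and is absorbed by the cofactors. *)
  have [k Ec] : exists k, c = k%:P by exists c`_0; exact: size1_polyC.
  have k0 : k != 0 by move: c0; rewrite Ec polyC_eq0.
  exists w, (k^-1%:P *: u1), (k^-1%:P *: v1); split => //.
    by rewrite -scalerAr -Eu Ec scalerA -polyCM mulVf // scale1r.
  by rewrite -scalerAr -Ev Ec scalerA -polyCM mulVf // scale1r.
have [p irr /dvdpP [c' Ec]] := irreducible_factor c1.
have p0 : p != 0 by have [p1 _] := irr; rewrite -size_poly_gt0; apply: ltn_trans p1.
have c'0 : c' != 0 by apply: contraNneq c0 => c'0; rewrite Ec c'0 mul0r.
have lt_c' : (size c' < n)%N.
  have [p1 _] := irr; move: le_n p1; rewrite Ec size_mul //.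
  by move: (size c') (size p) => a b; lia.
have injp : injective (fun z : {poly {poly F}} => p *: z).
  by move=> a b /=; rewrite -!mul_polyC => /(mulfI _) ->; rewrite ?polyC_eq0.
have pc (a b : {poly {poly F}}) : c *: a = w * b -> forall i, p %| (w * b)`_i.
  by move=> <- i; rewrite coefZ Ec mulrAC dvdp_mull.
have Ec2 (a : {poly {poly F}}) : c *: a = p *: (c' *: a).
  by rewrite scalerA Ec mulrC.
(* The prime factor [p] of [c] divides [w * u1] and [w * v1]: it is cancelled either from [w] or
   from both [u1] and [v1]. Cancelling it from [w] does not change the size of [w]. *)
have [/content_dvdP [w2 Ew]|nw] := pselect (forall i, p %| w`_i).
  have [||w' [u' [v' [sw Eu' Ev']]]] := IHn c' u v w2 u1 v1 lt_c' c'0.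
  - by apply: injp; rewrite /= -Ec2 Eu Ew -scalerAl.
  - by apply: injp; rewrite /= -Ec2 Ev Ew -scalerAl.
  by exists w', u', v'; split; rewrite // Ew size_scale.
have [//|/content_dvdP [u2 Eu1]] := irreducible_content irr (pc _ _ Eu).
have [//|/content_dvdP [v2 Ev1]] := irreducible_content irr (pc _ _ Ev).
by apply: (IHn c' u v w u2 v2) => //; apply: injp;
   rewrite /= -Ec2 ?Eu ?Ev ?Eu1 ?Ev1 -scalerAr.
Qed.

(** A vanishing resultant means a gcd of positive degree in y, which Gauss' lemma turns into a
    genuine common factor; dividing it out lowers the degree of [f]. *)
Lemma coprime_cofactors (F : fieldType) (f g : {poly {poly F}}) :
  f != 0 ->
  exists h u v : {poly {poly F}}, [/\ f = h * u, g = h * v & resultant u v != 0].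
Proof.
have [n le_n] := ubnP (size f); elim: n f g le_n => // n IHn f g le_n f0.
have [r0|] := eqVneq (resultant f g) 0; last first.
  by move=> r0; exists 1, f, g; rewrite !mul1r.
move/eqP: r0; rewrite resultant_eq0; set w := gcdp f g => w1.
have /Pdiv.Idomain.dvdpP [[c1 u1] /= c10 Eu] : Pdiv.Idomain.dvdp w f := dvdp_gcdl f g.
have /Pdiv.Idomain.dvdpP [[c2 v1] /= c20 Ev] : Pdiv.Idomain.dvdp w g := dvdp_gcdr f g.
(* Pseudo-division only makes [c1 *: f] and [c2 *: g] multiples of [w]; [c1 * c2] is a scalar that
   serves for both. *)
have [|||w' [u' [v' [sw Ef Eg]]]] := @common_factor_scale _ (c1 * c2) f g w (c2 *: u1) (c1 *: v1).
- by rewrite mulf_neq0.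
- by rewrite mulrC -scalerA Eu -scalerAr mulrC.
- by rewrite -scalerA Ev -scalerAr mulrC.
have w'0 : w' != 0 by apply: contraNneq f0 => w'0; rewrite Ef w'0 mul0r.
have u'0 : u' != 0 by apply: contraNneq f0 => u'0; rewrite Ef u'0 mulr0.
have [|h [u [v [Eh Eh2 r]]]] := IHn u' v' _ u'0.
  move: le_n w1; rewrite Ef size_mul // -sw; move: (size w') (size u') => a b; lia.
by exists (w' * h), u, v; split; rewrite // -mulrA -?Eh -?Eh2.
Qed.

(** * The program and its semantics *)

(* Variables of the programs: 0 ranges over the rows v; in the main loop, 1
   ranges over the fiber of row v + 1 and 2 over an auxiliary fiber. *)
Definition init_ones : prog :=
  ForRow 0 (ForFiber 1 (0, 0) (Seq (Init (Cell MatL (0, 0) 1) true)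
                                   (Init (Cell MatR (0, 0) 1) true)))%N.

(* Each point of row v + c, and each regular point of row v + 1, contributes
   through a matrix entry already equal to 1, since indices cannot be turned
   into integers. *)
Definition fill_critical (m : mat) (c : nat) : prog :=
  let z := Cell m (0, 1) 1 in
  (Seq (Init z false)
  (Seq (ForFiber 2 (0, c) (AddTo z z (Cell m (0, c) 2)))
       (ForFiber 2 (0, 1) (IfDelta (0, 1) 2 (SubTo z z (Cell m (0, 1) 2)) Skip))))%N.

Definition critical_entry : prog :=
  IfDelta (0, 1)%N 1 Skip (Seq (fill_critical MatL 0) (fill_critical MatR 2)).

Definition half_branch_prog : prog :=
  Seq init_ones (ForRow 0 (ForFiber 1 (0, 1)%N critical_entry)).

Section ProgramSemantics.
Variables (R : realType) (xs : seq R) (ys : seq (seq R)).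
Variable delta : nat -> nat -> bool.

Let n := size xs.
Let rr i := size (nth [::] ys i).
Let reg i w := count (delta i) (iota 0 w).
Let step_cost i := (rr i.-1 + rr i.+1 + 2 * reg i (rr i))%N.

(** Loop rule: [G i] describes the state before iteration [i]. *)
Lemma foldl_iota (T : Type) (f : T -> nat -> T) (G : nat -> T) k :
  (forall i, (i < k)%N -> f (G i) i = G i.+1) -> foldl f (G 0%N) (iota 0 k) = G k.
Proof.
elim: k => // k IHk fG; rewrite -{1}addn1 iotaD foldl_cat /= IHk ?add0n ?fG // => i ik.
by apply: fG; lia.
Qed.

Lemma reg_S i w : reg i w.+1 = (reg i w + delta i w)%N.
Proof. by rewrite /reg -{1}addn1 iotaD count_cat /= add0n addn0. Qed.

Definition update (M : memory) m i w z : memory :=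
  fun a i' j' => if [&& same_mat a m, i' == i & j' == w] then z else M a i' j'.

Lemma update_same M m i w z : update M m i w z m i w = z.
Proof. by rewrite /update !eqxx; case: m. Qed.

Lemma update_twice M m i w z z' : update (update M m i w z) m i w z' = update M m i w z'.
Proof.
apply/funext => a; apply/funext => i'; apply/funext => j'; rewrite /update.
by case: ifP => // ->.
Qed.

Lemma update_row M m i w z a i' j' : i' != i -> update M m i w z a i' j' = M a i' j'.
Proof. by move=> /negbTE ii'; rewrite /update ii' andbF. Qed.

Lemma update_col M m i w z a i' j' : j' != w -> update M m i w z a i' j' = M a i' j'.
Proof. by move=> /negbTE jj'; rewrite /update jj' !andbF. Qed.

(** Adding entries counts points because every entry read is 1. The entry being written is never
    read as a summand: [c != 1] separates the rows in the first loop, and [delta] excludes column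
    [w] in the second. *)
Lemma exec_fill_critical (e : env) M k m c v w :
  c != 1%N -> e 0%N = v -> e 1%N = w -> ~~ delta v.+1 w ->
  (forall u, (u < rr (v + c))%N -> M m (v + c)%N u = 1) ->
  (forall u, (u < rr v.+1)%N -> delta v.+1 u -> M m v.+1 u = 1) ->
  exec xs ys delta (fill_critical m c) e (State M k) =
  State (update M m v.+1 w ((rr (v + c))%:Z - (reg v.+1 (rr v.+1))%:Z))
        (k + (rr (v + c) + reg v.+1 (rr v.+1))).
Proof.
move=> c1 e0 e1 ndw Mc Mv /=.
have ev1 f : f 0%N = v -> eval_row f (0, 1)%N = v.+1.
  by rewrite /eval_row /= => ->; rewrite addn1.
have evc f : f 0%N = v -> eval_row f (0%N, c) = (v + c)%N by rewrite /eval_row /= => ->.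
have vc : (v + c)%N != v.+1 by rewrite -addn1 eqn_add2l.
rewrite -[State (write _ _ _ _) _]/(State (update M m (eval_row e (0, 1)%N) (e 1%N) 0) k).
rewrite ev1 // evc // e1.
pose G1 u := State (update M m v.+1 w u%:Z) (k + u).
have -> : State (update M m v.+1 w 0) k = G1 0%N by rewrite /G1 addn0.
rewrite (foldl_iota (G := G1)) => [|u ur]; last first.
  rewrite /G1 /read /=.
  rewrite -[write _ _ _ _]/(update _ m (eval_row (bind_var e 2 u) (0, 1)%N) (e 1%N) _).
  rewrite !ev1 // evc // /bind_var /= e1 update_twice update_same.
  by rewrite update_row // Mc // addnS intS [1 + _]addrC.
pose G2 u := State (update M m v.+1 w ((rr (v + c))%:Z - (reg v.+1 u)%:Z))
                   (k + (rr (v + c) + reg v.+1 u)).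
have -> : G1 (size (nth [::] ys (v + c))) = G2 0%N by rewrite /G1 /G2 /reg /= subr0 addn0.
rewrite (foldl_iota (G := G2)) // => u ur.
rewrite ev1 // {2}/bind_var /=; case: ifP => du; last by rewrite /G2 reg_S du addn0.
have uw : u != w by apply: contraNneq ndw => <-.
rewrite /G2 /read /=.
rewrite -[write _ _ _ _]/(update _ m (eval_row (bind_var e 2 u) (0, 1)%N) (e 1%N) _).
rewrite !ev1 // /bind_var /= e1 update_twice update_same update_col // Mv // reg_S du.
by rewrite addn1 !addnS intS [1 + _]addrC opprD addrA.
Qed.

Definition half_branch_value (a : mat) (i j : nat) : int :=
  if (j < rr i)%N then
    if delta i j then 1
    else (rr (if a is MatL then i.-1 else i.+1))%:Z - (reg i (rr i))%:Z
  else 0.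

Let ones (a : mat) i j : int := (j < rr i)%N%:Z.

(** Memory during initialization: rows before [v] and the first [w] points of row [v] are done. *)
Let M1 v w : memory :=
  fun _ i j => (((i < v) || ((i == v) && (j < w))) && (j < rr i))%N%:Z.

Lemma exec_init_ones : size ys = n -> 
  exec xs ys delta init_ones (fun=> 0%N) (State (fun _ _ _ => 0) 0) = State ones 0.
Proof.
move=> sys /=.
have -> : State (fun _ _ _ => 0) 0 = State (M1 0 0) 0.
  by congr State; do 3!apply/funext => ?; rewrite /M1 andbF.
pose G v := State (M1 v 0) 0.
rewrite -[State (M1 0 0) 0]/(G 0%N) (foldl_iota (G := G)) => [|v vn].
  congr State; do 3!apply/funext => ?; rewrite /M1 /ones andbF orbF -/n.
  case: ltnP => // le; rewrite /rr nth_default //; last by rewrite sys.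
pose G' w := State (M1 v w) 0.
rewrite -[G v]/(G' 0%N) /eval_row /bind_var /= addn0.
rewrite (foldl_iota (G := G')) => [|w wr].
  rewrite /G' /G; congr State; apply/funext => a; apply/funext => i; apply/funext => j.
  rewrite /M1 andbF orbF ltnS [(i <= v)%N]leq_eqVlt.
  by case: (ltngtP i v) => [_|_|->] //=; rewrite andbb.
rewrite /G' /write /eval_row /= addn0; congr State.
apply/funext => a; apply/funext => i; apply/funext => j; rewrite /M1 ltnS.
have [->|] := eqVneq i v; last by rewrite !andbF.
have [->|jw] := eqVneq j w; last by rewrite [(j < w)%N]ltn_neqAle jw !andbF.
by rewrite leqnn wr ltnn orbT; case: a.
Qed.

(** * The main loop, under the separation properties of critical points *)

Hypothesis sys : size ys = n.
Hypothesis delta0 : forall j, (j < rr 0)%N -> delta 0 j.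
Hypothesis delta_uniq : forall i j k, (j < rr i)%N -> (k < rr i)%N ->
  ~~ delta i j -> ~~ delta i k -> j = k.
Hypothesis delta_prev : forall i j k, (j < rr i.+1)%N -> ~~ delta i.+1 j ->
  (k < rr i)%N -> delta i k.

(** Memory during the main loop. Iteration [v] treats row [v.+1], so rows up to [v] included are
    final, and so are the first [w] entries of row [v.+1]. *)
Let M2 v w : memory := fun a i j =>
  if (i <= v)%N || ((i == v.+1) && (j < w)%N) then half_branch_value a i j else ones a i j.

(** At a critical point of row [v.+1] the left matrix is read in row [v], already final but all ones
    since its points are regular by [delta_prev], and the right matrix in row [v.+2], which still
    holds its initial ones. *)
Lemma exec_row_step (e : env) v w k : e 0%N = v -> (w < rr v.+1)%N ->
  exec xs ys delta critical_entry (bind_var e 1 w) (State (M2 v w) k) =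
  State (M2 v w.+1) (k + ~~ delta v.+1 w * step_cost v.+1).
Proof.
move=> e0 wr; set f := bind_var e 1 w.
rewrite -[LHS]/(if delta (e 0 + 1)%N w then State (M2 v w) k else
  exec xs ys delta (fill_critical MatR 2) f
    (exec xs ys delta (fill_critical MatL 0) f (State (M2 v w) k))) e0 addn1.
have [dw|ndw] := boolP (delta v.+1 w).
  rewrite mul0n addn0; congr State; apply/funext => a; apply/funext => i; apply/funext => j.
  rewrite /M2 ltnS; have [->|] := eqVneq i v.+1; last by [].
  rewrite ltnn /=; have [->|jw] := eqVneq j w; last by rewrite [(j < w)%N]ltn_neqAle jw.
  by rewrite ltnn leqnn /half_branch_value wr dw /ones wr.
have M2row u : (u < rr v.+1)%N -> delta v.+1 u -> forall a, M2 v w a v.+1 u = 1.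
  move=> ur du a; rewrite /M2 ltnn eqxx /=.
  by case: ifP; rewrite /half_branch_value /ones ur ?du.
rewrite (@exec_fill_critical _ _ _ MatL 0 v w) //; first last.
- by move=> u ur du; exact: M2row.
- move=> u; rewrite addn0 => ur; rewrite /M2 leqnn /= /half_branch_value ur.
  by rewrite (delta_prev wr ndw).
rewrite (@exec_fill_critical _ _ _ MatR 2 v w) //; first last.
- move=> u ur du; rewrite update_col ?M2row //.
  by apply: contraNneq ndw => <-.
- move=> u ur; rewrite update_row; last by rewrite addn2 gtn_eqF.
  have [le2 eq2] : (v + 2 <= v)%N = false /\ (v + 2 == v.+1)%N = false by lia.
  by rewrite /M2 le2 eq2 /ones ur.
have neq j : (j < rr v.+1)%N -> j != w -> delta v.+1 j.
  by move=> jr; apply: contraNT => nd; apply/eqP/(delta_uniq jr wr nd ndw).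
congr State; last by rewrite addn0 addn2 /step_cost /=; lia.
apply/funext => a; apply/funext => i; apply/funext => j.
rewrite /update /M2 ltnS addn2.
have [->|] := eqVneq i v.+1; last by rewrite !andbF.
rewrite ltnn /=; have [->|jw] := eqVneq j w; last by rewrite !andbF [(j < w)%N]ltn_neqAle jw.
rewrite !andbT leqnn /half_branch_value wr (negbTE ndw).
by case: a; rewrite ?addn0.
Qed.

Lemma run_half_branch_prog :
  run xs ys delta half_branch_prog =
  State (M2 n 0)
    (\sum_(v < n) count (predC (delta v.+1)) (iota 0 (rr v.+1)) * step_cost v.+1).
Proof.
rewrite -[LHS]/(foldl
  (fun t v => exec xs ys delta (ForFiber 1 (0, 1)%N critical_entry)
                (bind_var (fun=> 0%N) 0 v) t)
  (exec xs ys delta init_ones (fun=> 0%N) (State (fun _ _ _ => 0) 0)) (iota 0 n)).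
rewrite exec_init_ones //.
pose G v := State (M2 v 0)
  (\sum_(i < v) count (predC (delta i.+1)) (iota 0 (rr i.+1)) * step_cost i.+1).
(* The main loop never visits row 0; by [delta0] its initial ones are final. *)
have -> : State ones 0 = G 0%N.
  rewrite /G big_ord0; congr State; apply/funext => a; apply/funext => i; apply/funext => j.
  rewrite /M2 andbF orbF leqn0; case: eqP => // ->.
  by rewrite /ones /half_branch_value; case: ifP => // /delta0 ->.
(* The last iteration meets row [n], whose fiber is empty. *)
rewrite (foldl_iota (G := G)) // => v vn.
pose c w := count (predC (delta v.+1)) (iota 0 w).
pose G' w := State (M2 v w) (cost (G v) + c w * step_cost v.+1).
have -> : G v = G' 0%N by rewrite /G' /c mul0n addn0.
set e := bind_var _ 0 v.
rewrite -[LHS]/(foldl (fun t w => exec xs ys delta critical_entry (bind_var e 1 w) t)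
  (G' 0%N) (iota 0 (rr (v + 1)))) addn1.
rewrite (foldl_iota (G := G')) => [|w wr].
  rewrite /G' /G big_ord_recr /=; congr State.
  apply/funext => a; apply/funext => i; apply/funext => j.
  rewrite /M2 ltn0 andbF orbF [(i <= v.+1)%N]leq_eqVlt ltnS.
  have [->|ne] := eqVneq i v.+1; last by rewrite /= orbF.
  by rewrite ltnn /= /half_branch_value /ones; case: ltnP.
have -> : G' w.+1 = State (M2 v w.+1)
    (cost (G' w) + ~~ delta v.+1 w * step_cost v.+1).
  by rewrite /G' /c -{2}addn1 iotaD count_cat /= add0n addn0 mulnDl addnA.
exact: exec_row_step.
Qed.

Lemma run_entries i j a : (i < n)%N ->
  entries (run xs ys delta half_branch_prog) a i j = half_branch_value a i j.
Proof. by move=> ltin; rewrite run_half_branch_prog /= /M2 ltnW. Qed.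

Lemma run_cost :
  cost (run xs ys delta half_branch_prog) =
  (\sum_(v < n) count (predC (delta v.+1)) (iota 0 (rr v.+1)) * step_cost v.+1)%N.
Proof. by rewrite run_half_branch_prog. Qed.

End ProgramSemantics.

Local Open Scope classical_set_scope.
Local Open Scope ring_scope.

(** * Local structure of the zero set *)

Section LocalRoots.
Variable R : realType.
Implicit Types (g : {poly {poly R}}) (x y : R).

Definition fiber_poly g x : {poly R} := map_poly (horner_eval x) g.

Lemma evE g x y : ev g x y = (fiber_poly g x).[y].
Proof.
by rewrite /ev /fiber_poly -[(g.[_]).[x]]/(horner_eval x _) -horner_map /= /horner_eval hornerC.
Qed.

Lemma fiber_polyM g1 g2 x : fiber_poly (g1 * g2) x = fiber_poly g1 x * fiber_poly g2 x.
Proof. exact: rmorphM. Qed.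

Lemma fiber_poly_dy g x : fiber_poly (dy g) x = (fiber_poly g x)^`().
Proof. by rewrite /fiber_poly deriv_map. Qed.

Lemma evM g1 g2 x y : ev (g1 * g2) x y = ev g1 x y * ev g2 x y.
Proof. by rewrite !evE fiber_polyM hornerM. Qed.

Lemma ev_continuous g : continuous (fun p : R * R => ev g p.1 p.2).
Proof.
elim/poly_ind: g => [|g c IHg] p.
  rewrite (_ : (fun _ => _) = cst 0); first exact: cvg_cst.
  by apply/funext => q; rewrite evE /fiber_poly rmorph0 horner0.
rewrite (_ : (fun _ => _) = (fun q : R * R => ev g q.1 q.2 * q.2 + c.[q.1])); last first.
  by apply/funext => q; rewrite !evE /fiber_poly rmorphD rmorphM /= map_polyX map_polyC !hornerE.
apply: cvgD; first by apply: cvgM; [exact: IHg|exact: cvg_snd].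
by apply: (@continuous_comp _ _ _ fst (fun t => c.[t])); [exact: cvg_fst|exact: continuous_horner].
Qed.

Lemma ev_continuousl g y : continuous (fun x => ev g x y).
Proof. move=> x; exact: continuous_horner. Qed.

Lemma ev_neq0_near g x y : ev g x y != 0 ->
  exists2 e : R, 0 < e & \forall t \near x, forall z, `|z - y| < e -> ev g t z != 0.
Proof.
move=> g0.
have /= : \forall p \near (x, y), ev g p.1 p.2 != 0.
  have cont := @ev_continuous g (x, y).
  exact: (cvgr_neq0 _ cont).
case=> -[A B] /= [nA nB] sub.
have /nbhs_ballP [e /= e0 sB] := nB.
exists e => //; apply: filterS nA => t At z ze.
by apply: (sub (t, z)); split=> //=; apply: sB; rewrite /ball /= distrC.
Qed.

(** By Rolle, two roots close to [y] would enclose a zero of [dy g], which does not vanish near the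
    point. *)
Lemma simple_root_unique g x y : ev (dy g) x y != 0 ->
  exists2 e : R, 0 < e & \forall t \near x, forall z1 z2 : R,
    `|z1 - y| < e -> `|z2 - y| < e -> ev g t z1 = 0 -> ev g t z2 = 0 -> z1 = z2.
Proof.
move=> /ev_neq0_near[e e0 ne]; exists e => //; apply: filterS ne => t ne z1 z2.
wlog lt12 : z1 z2 / z1 < z2.
  move=> wl h1 h2 r1 r2; have [lt|lt|//] := ltgtP z1 z2; first exact: wl.
  by apply/esym; exact: wl.
move=> h1 h2 r1 r2; have := @poly_rolle _ z1 z2 (fiber_poly g t) lt12.
rewrite -!evE r1 r2 => /(_ erefl)[c]; rewrite in_itv /= => /andP[c1 c2].
rewrite -fiber_poly_dy -evE => /eqP; rewrite (negbTE (ne _ _)) //.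
by move: h1 h2; rewrite !ltr_norml; lra.
Qed.

(** The fiber polynomial changes sign at a simple root; the opposite signs at [y - t] and [y + t]
    survive a small change of abscissa, and the intermediate value theorem applies. *)
Lemma simple_root_persists g x y (e : R) : 0 < e -> ev g x y = 0 ->
  ev (dy g) x y != 0 ->
  \forall t \near x, exists2 z, `|z - y| < e & ev g t z = 0.
Proof.
move=> e0; rewrite !evE fiber_poly_dy => /rootP/factor_theorem[q Eq].
rewrite Eq derivM !hornerE derivXsubC hornerC subrr mulr0 add0r mulr1 => qy.
(* The cofactor [q] of the linear factor at [y] keeps its sign near [y], so the values of the fiber
   polynomial at [y - t] and [y + t] have product [- t ^+ 2] times a positive number. *)
have : \forall t \near (0 : R), 0 < q.[y - t] * q.[y + t].
  have cont : {for (0 : R), continuous (fun t => q.[y - t] * q.[y + t])}.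
    apply: cvgM.
      apply: (@continuous_comp _ _ _ (fun t => y - t) (horner q)); last exact: continuous_horner.
      by apply: cvgB; [exact: cvg_cst|exact: cvg_id].
    apply: (@continuous_comp _ _ _ (fun t => y + t) (horner q)); last exact: continuous_horner.
    by apply: cvgD; [exact: cvg_cst|exact: cvg_id].
  apply: (cvgr_gt _ cont); rewrite subr0 addr0 -expr2.
  by rewrite lt_def sqr_ge0 andbT expf_neq0.
move=> /nbhs_ballP[r /= r0 qpos].
pose t := Num.min e r / 2.
have [t0 te tr] : [/\ 0 < t, t < e & t < r].
  have m0 : 0 < Num.min e r by rewrite lt_min e0 r0.
  have [m1 m2] : Num.min e r <= e /\ Num.min e r <= r by rewrite !ge_min !lexx orbT.
  by rewrite /t; split; lra.
have qt : 0 < q.[y - t] * q.[y + t].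
  by apply: qpos; rewrite /ball /= sub0r normrN gtr0_norm.
have cont : {for x, continuous (fun s => ev g s (y - t) * ev g s (y + t))}.
  by apply: cvgM; exact: ev_continuousl.
have : ev g x (y - t) * ev g x (y + t) < 0.
  rewrite !evE Eq !hornerM !hornerXsubC.
  rewrite [ltLHS](_ : _ = - (t ^+ 2 * (q.[y - t] * q.[y + t]))); last by ring.
  by rewrite oppr_lt0 mulr_gt0 // exprn_gt0.
move=> /(cvgr_lt _ cont); apply: filterS => s.
rewrite !evE => /(poly_ivtoo (_ : y - t <= y + t))[|z]; first by lra.
rewrite in_itv /= => /andP[z1 z2] /rootP z0; exists z; last by rewrite evE.
by rewrite ltr_norml; apply/andP; split; lra.
Qed.

Lemma near_nonroot (p : {poly R}) x : p != 0 -> \forall t \near x^', p.[t] != 0.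
Proof.
move=> p0; have [m [q]] := multiplicity_XsubC p x; rewrite p0 /= => qx Ep.
have : \forall t \near x, q.[t] != 0.
  have cont := @continuous_horner _ q x.
  exact: (cvgr_neq0 _ cont).
rewrite /dnbhs /within /=; apply: filterS => t qt tx.
by rewrite Ep hornerM horner_exp hornerXsubC mulf_neq0 // expf_neq0 // subr_eq0.
Qed.

(* Through a zero with [dy h <> 0] passes an arc of zeros with pairwise
   distinct abscissas. *)
Lemma dy_eq0_of_finite_zeros h (T : seq R) x y :
  (forall t z, ev h t z = 0 -> t \in T) -> ev h x y = 0 -> ev (dy h) x y = 0.
Proof.
move=> zT hxy; apply/eqP; apply: contraT => dh.
(* The polynomial with root set [T] has no root in a punctured neighborhood of [x], yet zeros of [h]
   persist over it. *)
have := monic_neq0 (monic_prod_XsubC T xpredT id); move=> /near_nonroot.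
move=> /(_ x) nroot.
have : \forall t \near x^', exists2 z, `|z - y| < 1 & ev h t z = 0.
  by apply: nbhs_dnbhs; exact: simple_root_persists.
move=> /(filterI nroot)/filter_ex[t [+ [z _ /zT tT]]].
by rewrite -[_ != 0]/(~~ root _ t) root_prod_XsubC tT.
Qed.

End LocalRoots.

(** * Counting critical values *)

(** Each term of the Leibniz expansion of the Sylvester determinant is a product of
    [(size v).-1 + (size u).-1] entries of degree at most [D] in x. *)
Lemma size_resultant (F : fieldType) (u v : {poly {poly F}}) (D : nat) :
  (sizeY u <= D.+1)%N -> (sizeY v <= D.+1)%N ->
  (size (resultant u v) <= (D * ((size v).-1 + (size u).-1)).+1)%N.
Proof.
move=> uD vD; rewrite /resultant /determinant.
apply: leq_trans (size_sum _ _ _) _; apply/bigmax_leqP => s _.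
rewrite size_Msign; apply: leq_trans (size_poly_prod_leq _ _) _.
rewrite card_ord.
have le_entry i : (size (Sylvester_mx u v i (s i)) <= D.+1)%N.
  rewrite Sylvester_mxE /=; case: fintype.split => k; rewrite mulrb;
    case: ifP => _; rewrite ?size_poly0 //.
    exact: leq_trans (max_size_coefXY _ _) uD.
  exact: leq_trans (max_size_coefXY _ _) vD.
have := @leq_sum _ (index_enum _) xpredT _ _ (fun i _ => le_entry i).
rewrite sum_nat_const card_ord mulnS.
by set S := (\sum_(i < _) _)%N => leS; rewrite leq_subLR addnS ltnS mulnC.
Qed.

Lemma sizeY_mul (F : fieldType) (u v : {poly {poly F}}) :
  u != 0 -> v != 0 -> (sizeY (u * v)).-1 = ((sizeY u).-1 + (sizeY v).-1)%N.
Proof.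
move=> u0 v0; rewrite !sizeYE rmorphM /= size_mul ?swapXY_eq0 //.
have := size_poly_gt0 (swapXY u); have := size_poly_gt0 (swapXY v).
by rewrite !swapXY_eq0 u0 v0; move: (size _) (size _) => a b; lia.
Qed.

Lemma sizeY_deriv (F : fieldType) (u : {poly {poly F}}) : (sizeY u^`() <= sizeY u)%N.
Proof.
apply/bigmax_leqP => i _; rewrite coef_deriv.
have [->|n0] := eqVneq (u`_i.+1 *+ i.+1) 0; first by rewrite size_poly0.
apply: leq_trans (max_size_coefXY u i.+1).
by rewrite -scaler_nat size_scale_leq.
Qed.

Section Bezout.
Variable R : realType.
Implicit Types (g h u v : {poly {poly R}}) (zs T : seq R).

Lemma fiber_poly_size1 g x y :
  fiber_poly g x != 0 -> (size g <= 1)%N -> ev g x y != 0.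
Proof.
move=> + /size1_polyC Eg; rewrite evE Eg /fiber_poly map_polyC /= hornerC.
by rewrite polyC_eq0.
Qed.

(** The resultant lies in the ideal of [u] and [v], so the abscissas of common zeros are among its
    roots. This needs positive degree in y; the degenerate cases are treated apart. *)
Lemma coprime_common_zeros u v zs D :
  (forall x, fiber_poly u x != 0) -> resultant u v != 0 ->
  (sizeY u <= D.+1)%N -> (sizeY v <= D.+1)%N -> uniq zs ->
  {in zs, forall x, exists y, ev u x y = 0 /\ ev v x y = 0} ->
  (size zs <= D * ((size v).-1 + (size u).-1))%N.
Proof.
move=> u0 r0 uD vD uz zzs.
have root_bound (r : {poly R}) B : r != 0 -> (size r <= B.+1)%N ->
    (forall x y, ev u x y = 0 -> ev v x y = 0 -> root r x) -> (size zs <= B)%N.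
  move=> rn sr rz; rewrite -ltnS; apply: leq_trans sr.
  apply: max_poly_roots => //; apply/allP => x /zzs[y [u1 v1]].
  exact: rz u1 v1.
have [u1|u1] := leqP (size u) 1.
  case: zs uz zzs {root_bound} => //= x zs _ /(_ x (mem_head _ _))[y [/eqP]].
  by rewrite (negbTE (fiber_poly_size1 _ (u0 x) u1)).
(* If [v] is free of y, the polynomial [v] itself replaces the resultant; its degree fits the bound
   because [u] has positive degree in y. *)
have [v1|v1] := leqP (size v) 1.
  have Ev := size1_polyC v1.
  have v0 : v`_0 != 0.
    apply: contraNneq r0 => v0; rewrite resultant_eq0 Ev v0 polyC0.
    by rewrite gcdp0.
  apply: (root_bound v`_0) => // [|x y _].
    apply: leq_trans (max_size_coefXY _ _) (leq_trans vD _).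
    by rewrite ltnS leq_pmulr //; lia.
  by rewrite evE [in fiber_poly v x]Ev /fiber_poly map_polyC /= hornerC => /rootP.
apply: (root_bound (resultant u v)) => // [|x y ux vx].
  exact: size_resultant.
have [[a b] /= _ Er] := resultant_in_ideal u1 v1.
apply/rootP; have := congr1 (fun w => ev w x y) Er.
rewrite !evE /fiber_poly map_polyC /= hornerC.
rewrite -[(resultant _ _).[x]]/(horner_eval x _) => ->.
by rewrite rmorphD !rmorphM /= !hornerE -!evE ux vx !mulr0 addr0.
Qed.

(** [T] records that there are finitely many critical values. Zeros of the common factor are
    critical points of [g], so the same [T] serves in the induction. *)
Lemma critical_bound g zs T :
  (forall x, fiber_poly g x != 0) ->
  (forall x, critical_value g x -> x \in T) ->
  uniq zs -> {in zs, forall x, critical_value g x} ->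
  (size zs <= 2 * ((sizeY g).-1 * (size g).-1))%N.
Proof.
have [n le_n] := ubnP (size g).
elim: n g zs le_n => // n IHn g zs le_n g0 gT uz zzs.
have gn0 : g != 0.
  by apply: contraTneq (g0 0) => ->; rewrite /fiber_poly rmorph0 eqxx.
have [g1|g1] := leqP (size g) 1.
  case: zs uz zzs => //= x zs _ /(_ x (mem_head _ _))[[x' y] [/eqP]] /=.
  by rewrite (negbTE (fiber_poly_size1 _ (g0 x') g1)).
(* In characteristic 0 the top coefficient of the derivative is a nonzero multiple of the leading
   coefficient of [g]. *)
have dg0 : dy g != 0.
  apply/eqP => /(congr1 (fun w : {poly {poly R}} => w`_(size g).-2)).
  rewrite coef_deriv coef0 (_ : (size g).-2.+1 = (size g).-1); last by lia.
  move/eqP; rewrite -lead_coefE -scaler_nat scaler_eq0 pnatr_eq0 lead_coef_eq0 (negbTE gn0) orbF.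
  lia.
have [k [u [v [Eg Edg r0]]]] : exists k u v : {poly {poly R}},
  [/\ g = k * u, dy g = k * v & resultant u v != 0] := coprime_cofactors (dy g) gn0.
have [k0 u0] : k != 0 /\ u != 0.
  by move: gn0; rewrite Eg mulf_eq0 negb_or => /andP.
have v0 : v != 0 by move: dg0; rewrite Edg mulf_eq0 negb_or => /andP[].
have fk x : fiber_poly k x != 0 /\ fiber_poly u x != 0.
  by move: (g0 x); rewrite Eg fiber_polyM mulf_eq0 negb_or => /andP.
have kT x y : ev k x y = 0 -> critical_value g x.
  move=> kx; exists (x, y) => //; split; first by rewrite /curve /= Eg evM kx mul0r.
  by rewrite /= Edg evM kx mul0r.
have sz : [/\ ((size g).-1 = (size k).-1 + (size u).-1)%N, (0 < size g)%N,
               (0 < size k)%N & (0 < size u)%N].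
  have [] : (0 < size k)%N /\ (0 < size u)%N by rewrite !size_poly_gt0.
  by rewrite Eg size_mul //; move: (size k) (size u) => a b; split; lia.
have sdz : [/\ ((size k).-1 + (size v).-1 <= (size g).-2)%N & (0 < size v)%N].
  have [] : (0 < size k)%N /\ (0 < size v)%N by rewrite !size_poly_gt0.
  have := lt_size_deriv gn0; rewrite -/(dy g) Edg size_mul //.
  by move: (size k) (size v) (size g) => a b c; split; lia.
have sY : ((sizeY g).-1 = (sizeY k).-1 + (sizeY u).-1)%N by rewrite Eg sizeY_mul.
have sdY : ((sizeY k).-1 + (sizeY v).-1 <= (sizeY g).-1)%N.
  by rewrite -sizeY_mul // -Edg -!subn1 leq_sub2r // sizeY_deriv.
(* Abscissas below a zero of [k] are counted by induction, the others by the resultant of [u] and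
   [v]. *)
pose P x := `[< exists y, ev k x y = 0 >].
have cnt1 : (size (seq.filter P zs) <= 2 * ((sizeY k).-1 * (size k).-1))%N.
  apply: IHn; rewrite ?filter_uniq //.
  - by case: sz sdz => ? ? ? ? [? ?]; lia.
  - by move=> x; case: (fk x).
  - by move=> x [[x' y] [kx _] <-]; apply: gT; exact: kT kx.
  - move=> x; rewrite mem_filter => /andP[/asboolP[y ky] _].
    exists (x, y) => //; split => //.
    by apply: (@dy_eq0_of_finite_zeros _ _ T) => // t z kt; apply: gT; exact: kT kt.
have cnt2 : (size (seq.filter (predC P) zs) <= (sizeY u).-1 * ((size v).-1 + (size u).-1))%N.
  apply: coprime_common_zeros; rewrite ?filter_uniq //.
  - by move=> x; case: (fk x).
  - lia.
  - lia.
  - move=> x; rewrite mem_filter => /andP[/asboolPn nk /zzs[[x' y] [gx dgx] /= Ex]].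
    have kn : ev k x y != 0 by apply/eqP => kx; apply: nk; exists y.
    exists y; move: gx dgx; rewrite /curve /= Ex Edg Eg !evM.
    by move=> /eqP + /eqP; rewrite !mulf_eq0 (negbTE kn) /= => /eqP-> /eqP->.
have <- : (size (seq.filter P zs) + size (seq.filter (predC P) zs))%N = size zs.
  by rewrite !size_filter count_predC.
case: sz sdz => E1 _ _ _ [E2 _]; rewrite E1 sY.
(* Differentiation lowers the degree in y, so [v] has no larger degree than [u] and the resultant
   bound is at most twice the product of the two degrees of [u]. *)
have vu : ((size v).-1 <= (size u).-1)%N by lia.
have le2 : ((sizeY u).-1 * ((size v).-1 + (size u).-1) <= 2 * ((sizeY u).-1 * (size u).-1))%N.
  by rewrite mulnCA leq_mul2l; apply/orP; right; lia.
move: ((sizeY u).-1) ((size u).-1) ((sizeY k).-1) ((size k).-1) cnt1 le2 cnt2 => a b c d.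
nia.
Qed.

Lemma tdeg_size g : ((size g).-1 <= tdeg g)%N.
Proof.
have [->|g0] := eqVneq g 0; first by rewrite size_poly0.
have lt : ((size g).-1 < size g)%N by rewrite prednK // size_poly_gt0.
rewrite /tdeg (bigD1 (Ordinal lt)) /=; last by rewrite -lead_coefE lead_coef_eq0.
by rewrite (leq_trans _ (leq_maxl _ _)) // leq_addr.
Qed.

Lemma tdeg_sizeY g : ((sizeY g).-1 <= tdeg g)%N.
Proof.
rewrite -[tdeg g]/(tdeg g).+1.-1 -!subn1 leq_sub2r //.
apply/bigmax_leqP => i _.
have [->|gi] := eqVneq g`_i 0; first by rewrite size_poly0.
rewrite /tdeg (bigD1 i) //=; apply: leq_trans (leqSpred _) _; rewrite ltnS.
by apply: leq_trans (leq_maxl _ _); exact: leq_addl.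
Qed.

End Bezout.

(** * Branches *)

Section Branches.
Variable R : realType.
Implicit Types (g : {poly {poly R}}) (x y : R).

Definition fiber_roots g x : seq R := rootsR (fiber_poly g x).

Lemma mem_fiber_roots g x y : fiber_poly g x != 0 ->
  (y \in fiber_roots g x) <-> ev g x y = 0.
Proof.
move=> g0; rewrite evE -(roots_on_rootsR g0) in_itv /=.
by split => /rootP.
Qed.

Lemma fiber_roots_sorted g x : sorted <%R (fiber_roots g x).
Proof. exact: sorted_roots. Qed.

Lemma near_in_seq (U : Type) (F : set_system U) (A : eqType) (s : seq A)
  (P : A -> U -> Prop) : Filter F ->
  {in s, forall a, \forall u \near F, P a u} ->
  \forall u \near F, {in s, forall a, P a u}.
Proof.
move=> FF; elim: s => [|a s IHs] Ps; first by apply: filterE => u.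
have Pa : \forall u \near F, P a u by apply: Ps; exact: mem_head.
have Pt : \forall u \near F, {in s, forall a, P a u}.
  by apply: IHs => b bs; apply: Ps; rewrite in_cons bs orbT.
apply: filterS2 Pa Pt => u Pau Ptu b; rewrite in_cons => /orP[/eqP->|] //.
exact: Ptu.
Qed.

Lemma lead_coef_fiber_neq0 g x : (lead_coef g).[x] != 0 ->
  lead_coef (fiber_poly g x) = (lead_coef g).[x] /\ size (fiber_poly g x) = size g.
Proof.
move=> lc0; rewrite /fiber_poly lead_coef_map_eq //.
by rewrite size_map_poly_id0.
Qed.

Lemma fiber_poly_neq0 g x : (lead_coef g).[x] != 0 -> fiber_poly g x != 0.
Proof. by move=> lc0; rewrite -lead_coef_eq0; have [->] := lead_coef_fiber_neq0 lc0. Qed.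

(** Where the leading coefficient does not vanish, Cauchy's root bound, here [M t], is continuous in
    the abscissa. *)
Lemma roots_locally_bounded g x : (lead_coef g).[x] != 0 ->
  exists B : R, \forall t \near x, forall z, ev g t z = 0 -> `|z| <= B.
Proof.
move=> lc0.
pose M t := 1 + `|(lead_coef g).[t]|^-1 * \sum_(i < size g) `|(g`_i).[t]|.
have contM : {for x, continuous M}.
  apply: cvgD; first exact: cvg_cst.
  apply: cvgM.
    apply: cvgV; first by rewrite normr_eq0.
    by apply: cvg_norm; exact: continuous_horner.
  apply: cvg_big => [|i _]; first exact: add_continuous.
  by apply: cvg_norm; exact: continuous_horner.
exists (M x + 1).
have lcn : \forall t \near x, (lead_coef g).[t] != 0.
  have cont := @continuous_horner _ (lead_coef g) x.
  exact: (cvgr_neq0 _ cont).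
have Mn : \forall t \near x, M t < M x + 1 by apply: (cvgr_lt _ contM); rewrite ltrDl.
apply: filterS2 lcn Mn => t lct Mt z; rewrite evE => /(cauchy_boundP (fiber_poly_neq0 lct)).
move=> /ltW/le_trans; apply; apply: le_trans (ltW Mt).
have [lcE szE] := lead_coef_fiber_neq0 lct.
rewrite /cauchy_bound lcE szE lerD2l; under eq_bigr do rewrite coef_map.
exact: lexx.
Qed.

(** Roots over nearby abscissas stay in a compact interval. Away from the roots over [x]
    nonvanishing is an open condition, and compactness makes it uniform in [t]. *)
Lemma near_roots_close g x (e : R) : (lead_coef g).[x] != 0 -> 0 < e ->
  \forall t \near x, forall z, ev g t z = 0 ->
    exists2 y, y \in fiber_roots g x & `|z - y| < e.
Proof.
move=> lc0 e0; have [B Bnd] := roots_locally_bounded lc0.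
pose P t z := ev g t z = 0 -> exists2 y, y \in fiber_roots g x & `|z - y| < e.
have : \forall t \near x, `[- B, B] `<=` P t.
  have /compact_near_coveringP cov := @segment_compact R (- B) B.
  apply: (cov _ (nbhs x) P) => z _.
  have [z0|/ev_neq0_near[r r0 nr]] := eqVneq (ev g x z) 0.
    exists (ball z e, setT) => /=.
      by split; [exact: nbhsx_ballx|exact: filterT].
    move=> [w t] [/= wz _ _]; exists z; last by rewrite distrC.
    by apply/mem_fiber_roots => //; exact: fiber_poly_neq0.
  exists (ball z r, [set t | forall w, `|w - z| < r -> ev g t w != 0]) => /=.
    by split; [exact: nbhsx_ballx|].
  by move=> [w t] [/= wz /(_ w) nw /eqP]; rewrite (negbTE (nw _)) // distrC.
apply: filterS2 Bnd => t Bt Pt z z0; apply: Pt => //=.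
by rewrite in_itv /= -ler_norml Bt.
Qed.

(** Each simple root continues to exactly one nearby root and no root comes from elsewhere, so the
    sorted lists of roots correspond index by index. *)
Lemma fiber_roots_near g x (e : R) : (lead_coef g).[x] != 0 ->
  (forall y, ev g x y = 0 -> ev (dy g) x y != 0) -> 0 < e ->
  \forall t \near x, size (fiber_roots g t) = size (fiber_roots g x) /\
    forall j, (j < size (fiber_roots g x))%N ->
      `|(fiber_roots g t)`_j - (fiber_roots g x)`_j| < e.
Proof.
move=> lc0 simple e0; set s := fiber_roots g x.
have sP y : y \in s <-> ev g x y = 0 by exact/mem_fiber_roots/fiber_poly_neq0.
have uniq_near : \forall r \near (0 : R)^'+, {in s, forall y, \forall t \near x,
    forall z1 z2 : R, `|z1 - y| < r -> `|z2 - y| < r ->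
    ev g t z1 = 0 -> ev g t z2 = 0 -> z1 = z2}.
  apply: near_in_seq => y ys.
  have [d d0 dP] := simple_root_unique (simple y (iffLR (sP y) ys)).
  apply: filterS (nbhs_right_lt d0) => r rd; apply: filterS dP => t dP z1 z2 h1 h2.
  by apply: dP; apply: lt_trans rd.
(* The radius [r] is taken so small that the intervals around distinct roots are disjoint. *)
have gap_near : \forall r \near (0 : R)^'+,
    {in s, forall y, {in s, forall z, y < z -> y + r < z - r}}.
  apply: near_in_seq => y ys; apply: near_in_seq => z zs.
  case: (ltP y z) => yz; last exact: filterE.
  have d0 : 0 < (z - y) / 2 by lra.
  by apply: filterS (nbhs_right_lt d0) => r rd _; lra.
have [r [[r0 re] [uniq_r gap]]] := filter_ex
  (filterI (filterI (nbhs_right_gt 0) (nbhs_right_lt e0)) (filterI uniq_near gap_near)).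
have ex_r : \forall t \near x, {in s, forall y, exists2 z, `|z - y| < r & ev g t z = 0}.
  apply: (@near_in_seq _ (nbhs x)) => y /sP y0; exact: simple_root_persists (simple y y0).
have un_r : \forall t \near x, {in s, forall y, forall z1 z2 : R, `|z1 - y| < r ->
       `|z2 - y| < r -> ev g t z1 = 0 -> ev g t z2 = 0 -> z1 = z2}.
  exact: (@near_in_seq _ (nbhs x)).
have lcn : \forall t \near x, (lead_coef g).[t] != 0.
  have cont := @continuous_horner _ (lead_coef g) x.
  exact: (cvgr_neq0 _ cont).
apply: filterS3 (filterI ex_r un_r) lcn (near_roots_close lc0 r0) => t [ext unt] lct close_t.
(* [eta y] is the continuation of [y] over [t]; [gap] makes [eta] increasing on [s], so [map eta s]
   is already the sorted list of roots. *)
have /choice[eta etaP] : forall y, exists z, y \in s -> `|z - y| < r /\ ev g t z = 0.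
  move=> y; case: (boolP (y \in s)) => [/ext[z zy z0]|_]; last by exists 0.
  by exists z.
have Et : fiber_roots g t = map eta s.
  apply: (irr_sorted_eq lt_trans ltxx) => [||z].
  - exact: fiber_roots_sorted.
  - apply: (homo_sorted_in (P := mem s)); last exact: fiber_roots_sorted.
      move=> y z ys zs yz; have := gap _ ys _ zs yz.
      have [+ _] := etaP _ ys; have [+ _] := etaP _ zs.
      by rewrite !ltr_norml; lra.
    by apply/allP.
  - apply/idP/mapP => [/(mem_fiber_roots _ (fiber_poly_neq0 lct)) z0|[y ys ->]].
      have [y ys zy] := close_t z z0; exists y => //.
      by have [ey e0'] := etaP _ ys; apply: (unt y ys).
    by apply/(mem_fiber_roots _ (fiber_poly_neq0 lct)); have [] := etaP _ ys.
rewrite Et size_map; split => // j js; rewrite (nth_map 0) //.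
have [ej _] := etaP _ (mem_nth 0 js); exact: lt_trans re.
Qed.

(** The number of roots is locally constant, hence continuous as a real function; if it varied, it
    would take a half-integer value. *)
Lemma fiber_roots_size_constant g (a b : R) :
  {in `]a, b[, forall x, (lead_coef g).[x] != 0} ->
  {in `]a, b[, forall x, regular_value g x} ->
  {in `]a, b[ &, forall x1 x2, size (fiber_roots g x1) = size (fiber_roots g x2)}.
Proof.
move=> lc reg x1 x2.
wlog le12 : x1 x2 / x1 <= x2.
  move=> wl i1 i2; case/orP: (le_total x1 x2) => le; first exact: wl.
  by apply/esym; exact: wl.
move=> i1 i2; set N := fun t => size (fiber_roots g t).
have iab t : t \in `[x1, x2] -> t \in `]a, b[.
  by move: i1 i2; rewrite !in_itv /=; lra.
have contN : {within `[x1, x2], continuous (fun t => (N t)%:R : R)}.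
  apply: continuous_in_subspaceT => t; rewrite inE /= => /iab tab.
  apply: cvg_near_cst.
  have simple y : ev g t y = 0 -> ev (dy g) t y != 0.
    by move=> gy; apply/eqP => dgy; apply: (reg _ tab); exists (t, y).
  by apply: filterS (fiber_roots_near (lc _ tab) simple ltr01) => u [Eu _]; rewrite /N Eu.
have half (u v : R) : u + 1 <= v -> Num.min u v <= u + 2^-1 <= Num.max u v.
  by move=> ?; rewrite ge_min le_max; apply/andP; split; apply/orP; [left|right]; lra.
have ltN (u v : nat) : (u < v)%N -> u%:R + 1 <= v%:R :> R by rewrite natr1 ler_nat.
have nohalf (u v : nat) : u%:R <> v%:R + 2^-1 :> R.
  move=> /(congr1 (fun w => w * 2)); rewrite mulrDl mulVf ?pnatr_eq0 //.
  by rewrite -!natrM natr1 => /eqP; rewrite eqr_nat; lia.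
case: (ltngtP (N x1) (N x2)) => // lt.
  by have [c _ /nohalf] := IVT le12 contN (half _ _ (ltN _ _ lt)).
have := half _ _ (ltN _ _ lt); rewrite minC maxC => h.
by have [c _ /nohalf] := IVT le12 contN h.
Qed.

(** Supplies branches outside of the partition, where the given branch system says nothing: the
    branch of index [k] is the root of index [k] in increasing order. *)
Lemma branches_exist g (a b : R) :
  {in `]a, b[, forall x, (lead_coef g).[x] != 0} ->
  {in `]a, b[, forall x, regular_value g x} ->
  exists rho (phi : 'I_rho -> R -> R), branches g a b phi.
Proof.
move=> lc reg; have [ab|ba] := ltP a b; last first.
  exists 0%N, (fun _ _ => 0).
  by split => [[]|x|x] //; rewrite in_itv /=; lra.
have mab : (a + b) / 2 \in `]a, b[ by rewrite in_itv /=; lra.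
pose rho := size (fiber_roots g ((a + b) / 2)).
have szE x : x \in `]a, b[ -> size (fiber_roots g x) = rho.
  by move=> xab; apply: fiber_roots_size_constant xab mab.
exists rho, (fun k x => (fiber_roots g x)`_k); split => [k x xab|x xab k l kl|x xab y].
- apply/cvgrPdist_lt => e e0.
  have simple y : ev g x y = 0 -> ev (dy g) x y != 0.
    by move=> gy; apply/eqP => dgy; apply: (reg _ xab); exists (x, y).
  apply: filterS (fiber_roots_near (lc _ xab) simple e0) => t [_ /(_ k)].
  by rewrite distrC szE // => ->.
- by rewrite (lt_sorted_ltn_nth 0 (fiber_roots_sorted g x)) ?inE ?szE.
- rewrite /curve /= -(mem_fiber_roots _ (fiber_poly_neq0 (lc _ xab))).
  split => [/(nthP 0)[j + <-]|[k <-]]; last by rewrite mem_nth ?szE.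
  by rewrite szE // => jr; exists (Ordinal jr).
Qed.

End Branches.

(** * Half-branches at regular points *)

Section HalfBranches.
Variable R : realType.
Implicit Types (g : {poly {poly R}}) (x y : R).

(** A branch leaving the band of width [e] around [y] would at some point be at distance exactly
    [e], and uniqueness within [e0] would identify it with the root at distance less than [e]. *)
Lemma branch_stays g (a b c d y e e0 : R) rho (phi : 'I_rho -> R -> R) k :
  branches g a b phi ->
  (forall t, c < t < d -> a < t < b) -> e < e0 ->
  (forall t, c < t < d -> exists2 z, `|z - y| < e & ev g t z = 0) ->
  (forall t, c < t < d -> forall z1 z2 : R, `|z1 - y| < e0 -> `|z2 - y| < e0 ->
    ev g t z1 = 0 -> ev g t z2 = 0 -> z1 = z2) ->
  forall t1 t2, c < t1 < d -> c < t2 < d ->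
  `|phi k t1 - y| < e -> `|phi k t2 - y| < e.
Proof.
move=> [cont _ rootP] cdab ee0 ext unt t1 t2 t1cd t2cd h1.
rewrite ltNge; apply/negP => h2.
have noedge t : c < t < d -> `|phi k t - y| != e.
  move=> tcd; apply/eqP => pe; have [z ze z0] := ext _ tcd.
  have : phi k t = z.
    apply: (unt t tcd) => //; [by rewrite pe|exact: lt_trans ee0|].
    apply/(rootP t) => //; last by exists k.
    by rewrite in_itv /= cdab.
  by move=> Ez; move: ze; rewrite -Ez pe ltxx.
have contf (s1 s2 : R) : c < s1 < d -> c < s2 < d ->
    {within `[s1, s2], continuous (fun t => `|phi k t - y|)}.
  move=> s1cd s2cd; apply: continuous_in_subspaceT => t.
  rewrite inE /= in_itv /= => /andP[s1t ts2].
  apply: cvg_norm; apply: cvgB; last exact: cvg_cst.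
  by apply: cont; rewrite in_itv /= cdab //; move: s1cd s2cd; lra.
have between (s1 s2 t : R) : c < s1 < d -> c < s2 < d -> t \in `[s1, s2] -> c < t < d.
  by rewrite in_itv /=; lra.
have [le12|/ltW le21] := leP t1 t2.
  have [|t t12 /eqP] := @IVT _ _ _ _ e le12 (contf _ _ t1cd t2cd).
    by rewrite ge_min le_max h2 (ltW h1) orbT.
  by rewrite (negbTE (noedge _ (between _ _ _ t1cd t2cd t12))).
have [|t t12 /eqP] := @IVT _ _ _ _ e le21 (contf _ _ t2cd t1cd).
  by rewrite ge_min le_max h2 (ltW h1) orbT.
by rewrite (negbTE (noedge _ (between _ _ _ t2cd t1cd t12))).
Qed.

(* [F] is one of the two one-sided neighborhood filters of [x]. *)
Lemma unique_half_branch g (F : set_system R) (a b x y : R) rho (phi : 'I_rho -> R -> R) :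
  ProperFilter F -> nbhs x `<=` F ->
  (forall A : set R, nbhs x A -> exists c d : R,
     [/\ c < d, forall t, c < t < d -> A t /\ a < t < b & F [set t | c < t < d]]) ->
  branches g a b phi -> ev g x y = 0 -> ev (dy g) x y != 0 ->
  #|[pred k : 'I_rho | `[< phi k t @[t --> F] --> y >]]| = 1%N.
Proof.
move=> FF nF side br gxy dgxy; have [cont incr rootP] := br.
have [e0 e00 unq] := simple_root_unique dgxy.
have e_gt0 : 0 < e0 / 2 by lra.
have [c [d [cd cdP Fcd]]] := side _ (filterI unq (simple_root_persists e_gt0 gxy dgxy)).
have cdab t : c < t < d -> t \in `]a, b[.
  by move=> /cdP[_]; rewrite in_itv.
have mid : c < (c + d) / 2 < d by lra.
have [[_ [z1 z1e z10]] _] := cdP _ mid.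
(* The half-branch sought is the branch through the persisting root over the midpoint; it stays in
   the band. *)
have [k Ek] : exists k, phi k ((c + d) / 2) = z1 by apply/rootP => //; exact: cdab.
have stay t : c < t < d -> `|phi k t - y| < e0.
  move=> tcd; have e2 : e0 / 2 < e0 by lra.
  apply: lt_trans (e2).
  have cdb s : c < s < d -> a < s < b by move=> /cdP[].
  apply: (branch_stays br cdb e2 _ _ mid tcd) => //; rewrite ?Ek //.
  - by move=> s /cdP[[]].
  - by move=> s /cdP[[]].
have cvgk : phi k t @[t --> F] --> y.
  apply/cvgrPdist_lt => eps eps0.
  have m0 : 0 < Num.min eps e0 by rewrite lt_min eps0.
  have /nF near_ex := simple_root_persists m0 gxy dgxy.
  apply: filterS2 Fcd near_ex => t tcd [z]; rewrite lt_min => /andP[zeps ze0] z0.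
  have [[unt _] _] := cdP _ tcd.
  rewrite distrC (_ : phi k t = z) //; apply: unt => //; first exact: stay.
  by apply/(rootP t (cdab _ tcd)); exists k.
(* Another branch tending to [y] would enter the band, hence meet [phi k], against the strict order
   of branches. *)
apply/eqP; rewrite -(card1 k); apply/eqP/eq_card => l; rewrite !inE.
apply/asboolP/eqP => [|-> //].
move=> /cvgrPdist_lt/(_ _ e00)/(filterI Fcd)/filter_ex[t [tcd lt]].
have [[unt _] _] := cdP _ tcd.
have El : phi l t = phi k t.
  apply: unt; [by rewrite distrC|exact: stay| |];
    by apply/(rootP t (cdab _ tcd)); eexists.
apply/val_inj/eqP; case: ltngtP => // /(incr t (cdab _ tcd)); by rewrite El ltxx.
Qed.

Lemma unique_branch_left g (a b y : R) rho (phi : 'I_rho -> R -> R) :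
  a < b -> branches g a b phi -> ev g b y = 0 -> ev (dy g) b y != 0 ->
  #|[pred k : 'I_rho | `[< phi k t @[t --> b^'-] --> y >]]| = 1%N.
Proof.
move=> ab; apply: unique_half_branch => [A nA|A /nbhs_ballP[r /= r0 rA]].
  by apply: filterS nA.
have mb : Num.max a (b - r) < b by rewrite gt_max ab; lra.
exists (Num.max a (b - r)), b; split => //.
- move=> t; rewrite gt_max => /andP[/andP[at_ rt] tb]; split; last by rewrite at_.
  by apply: rA; rewrite /ball /= gtr0_norm; lra.
- by apply: filterS2 (nbhs_left_gt mb) (nbhs_left_lt b) => t /= -> ->.
Qed.

Lemma unique_branch_right g (a b y : R) rho (phi : 'I_rho -> R -> R) :
  a < b -> branches g a b phi -> ev g a y = 0 -> ev (dy g) a y != 0 ->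
  #|[pred k : 'I_rho | `[< phi k t @[t --> a^'+] --> y >]]| = 1%N.
Proof.
move=> ab; apply: unique_half_branch => [A nA|A /nbhs_ballP[r /= r0 rA]].
  by apply: filterS nA.
have am : a < Num.min b (a + r) by rewrite lt_min ab; lra.
exists a, (Num.min b (a + r)); split => //.
- move=> t; rewrite lt_min => /andP[at_ /andP[tb rt]]; split; last by rewrite at_.
  by apply: rA; rewrite /ball /= distrC gtr0_norm; lra.
- by apply: filterS2 (nbhs_right_lt am) (nbhs_right_gt a) => t /= -> ->.
Qed.

Lemma unique_branch_endpoints g (a b : R) rho (phi : 'I_rho -> R -> R) :
  a < b -> branches g a b phi -> (forall k, {within `[a, b], continuous (phi k)}) ->
  (forall y, ev g a y = 0 -> ev (dy g) a y != 0 ->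
     #|[pred k : 'I_rho | phi k a == y]| = 1%N) /\
  (forall y, ev g b y = 0 -> ev (dy g) b y != 0 ->
     #|[pred k : 'I_rho | phi k b == y]| = 1%N).
Proof.
move=> ab br cont; split => y gy dgy.
  rewrite -(unique_branch_right ab br gy dgy); apply: eq_card => k; rewrite !inE.
  have [_ cvga _] := (continuous_within_itvP (phi k) ab).1 (cont k).
  by apply/eqP/asboolP => [<- //|cvgy]; exact: (cvg_unique _ cvga cvgy).
rewrite -(unique_branch_left ab br gy dgy); apply: eq_card => k; rewrite !inE.
have [_ _ cvgb] := (continuous_within_itvP (phi k) ab).1 (cont k).
by apply/eqP/asboolP => [<- //|cvgy]; exact: (cvg_unique _ cvgb cvgy).
Qed.

Lemma end_half_left_regular g (x y : R) : g != 0 ->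
  (forall t, t < x -> regular_value g t) -> ev g x y = 0 -> ev (dy g) x y != 0 ->
  end_half_left g x y 1.
Proof.
move=> g0 reg gy dgy.
have lc0 : lead_coef g != 0 by rewrite lead_coef_eq0.
(* The width [e] keeps the leading coefficient nonzero over the interval, so that no root escapes to
   infinity inside it. *)
have := @near_nonroot _ _ x lc0; rewrite /dnbhs /within /= => /nbhs_ballP[e /= e0 eP].
have [|t|rho [phi br]] := @branches_exist _ g (x - e) x.
- move=> t; rewrite in_itv /= => /andP[et tx]; apply: eP; last by rewrite lt_eqF.
  by rewrite /ball /= gtr0_norm; lra.
- by rewrite in_itv /= => /andP[_ /reg].
exists e, rho, phi; split => //.
by rewrite (unique_branch_left _ br) //; lra.
Qed.

Lemma end_half_right_regular g (x y : R) : g != 0 ->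
  (forall t, x < t -> regular_value g t) -> ev g x y = 0 -> ev (dy g) x y != 0 ->
  end_half_right g x y 1.
Proof.
move=> g0 reg gy dgy.
have lc0 : lead_coef g != 0 by rewrite lead_coef_eq0.
have := @near_nonroot _ _ x lc0; rewrite /dnbhs /within /= => /nbhs_ballP[e /= e0 eP].
have [|t|rho [phi br]] := @branches_exist _ g x (x + e).
- move=> t; rewrite in_itv /= => /andP[xt te]; apply: eP; last by rewrite gt_eqF.
  by rewrite /ball /= distrC gtr0_norm; lra.
- by rewrite in_itv /= => /andP[/reg].
exists e, rho, phi; split => //.
by rewrite (unique_branch_right _ br) //; lra.
Qed.

(* Every branch ends in the fiber, so the half-branches at the points of a
   fiber add up to the number of branches. *)
Lemma sum_half_branches (s : seq R) rho (f : 'I_rho -> R) :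
  uniq s -> (forall k, f k \in s) ->
  (\sum_(j < size s) #|[pred k : 'I_rho | f k == (s`_j)%R]|)%N = rho.
Proof.
move=> us fs; rewrite -[RHS]card_ord -sum1_card.
(* The branches are partitioned by the index of their endpoint in the fiber. *)
pose h k : 'I_(size s) := Ordinal (eqbRL (index_mem (f k) s) (fs k)).
rewrite (partition_big h xpredT) //=; apply: eq_bigr => j _.
rewrite -sum1_card; apply: eq_bigl => k; rewrite !inE.
apply/eqP/eqP => [Ef|<-]; last by rewrite /= nth_index.
by apply/val_inj; rewrite /= Ef index_uniq.
Qed.

End HalfBranches.

(** * Correctness and cost *)

(** Used with [c] the half-branch counts of a critical fiber and [p] the regularity test: the
    critical point carries what the regular points leave. *)
Lemma sum_one_exception (r j : nat) (c : nat -> nat) (p : pred nat) :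
  (j < r)%N -> ~~ p j -> (forall u, (u < r)%N -> p u -> c u = 1%N) ->
  (forall u, (u < r)%N -> ~~ p u -> u = j) ->
  (\sum_(u < r) c u = c j + count p (iota 0 r))%N.
Proof.
move=> jr npj c1 uniq_j; rewrite (bigD1 (Ordinal jr)) //=; congr addn.
have -> : count p (iota 0 r) = (\sum_(u < r | p u) 1)%N.
  by rewrite -(big_mkord p (fun=> 1%N)) /index_iota subn0 sum1_count.
apply: eq_big => [u|u nu]; last first.
  by apply: c1 => //; apply: contraNT nu => /(uniq_j _ (ltn_ord u)) uj; apply/eqP/val_inj.
apply/idP/idP => [nu|pu].
  by apply: contraNT nu => /(uniq_j _ (ltn_ord u)) uj; apply/eqP/val_inj.
by apply: contraNneq npj => uj; rewrite -[j]/(nat_of_ord (Ordinal jr)) -uj.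
Qed.

Lemma count_exception_le (r : nat) (p : pred nat) :
  (forall u v, (u < r)%N -> (v < r)%N -> ~~ p u -> ~~ p v -> u = v) ->
  (count (predC p) (iota 0 r) <= has (predC p) (iota 0 r))%N.
Proof.
move=> uniq_p; case: hasP => [[j]|none].
  rewrite mem_iota add0n /= => jr npj.
  have /eqP := sum_one_exception (c := fun=> 1%N) jr npj
    (fun _ _ _ => erefl) (fun u ur npu => uniq_p _ _ ur jr npu npj).
  rewrite sum1_card card_ord -[X in X == _](size_iota 0) -(count_predC p) addnC.
  by rewrite eqn_add2r => /eqP ->.
rewrite leqn0 -leqn0 leqNgt -has_count; apply/hasP => -[j jr npj].
by apply: none; exists j.
Qed.

(** * Comparison of the half-branch counts with the program, and the cost bound *)

Section Assembly.
Variables (R : realType) (g : {poly {poly R}}) (xs : seq R) (ys : seq (seq R)).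
Variables (rho : nat -> nat) (phi : forall i : nat, 'I_(rho i) -> R -> R).
Variable delta : nat -> nat -> bool.
Hypothesis gen : general_position g.
Hypothesis part : good_partition g xs.
Hypothesis fib : fibers g xs ys.
Hypothesis bran : branch_system g xs phi.
Hypothesis deltaP : forall i j : nat, (i < size xs)%N -> (j < size (nth [::] ys i))%N ->
  delta i j <-> ev (dy g) xs`_i (nth [::] ys i)`_j <> 0.

Let n := size xs.
Let rr i := size (nth [::] ys i).
Let y i j : R := (nth [::] ys i)`_j.

Let xs_lt i j : (i < n)%N -> (j < n)%N -> (xs`_i < xs`_j) = (i < j)%N.
Proof. by have [sx _ _] := part; move=> ltin ltjn; rewrite lt_sorted_ltn_nth. Qed.

Let xs_inj i j : (i < n)%N -> (j < n)%N -> xs`_i = xs`_j -> i = j.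
Proof.
move=> ltin ltjn E; apply/eqP; case: ltngtP => //; rewrite -xs_lt // E ltxx //.
Qed.

(** Otherwise the curve would contain a vertical line, against finiteness of fibers; a point off the
    finite fiber is found as a nonroot of the polynomial with that root set. *)
Lemma fiber_poly_neq0_of_general_position x : fiber_poly g x != 0.
Proof.
have [_ /(_ x)/finite_seqP[T ET] _] := gen.
have := monic_neq0 (monic_prod_XsubC [seq p.2 | p <- T] xpredT id).
move=> /near_nonroot => /(_ 0)/filter_ex[t nt]; apply: contraNneq nt => f0.
rewrite -[_ == 0]/(root _ t) root_prod_XsubC; apply/mapP; exists (x, t) => //.
have : (curve g `&` [set p | p.1 = x]) (x, t) by split; rewrite /curve //= evE f0 horner0.
by rewrite ET.
Qed.

Let g_neq0 : g != 0.
Proof.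
apply: contraTneq (fiber_poly_neq0_of_general_position 0) => ->.
by rewrite /fiber_poly rmorph0 eqxx.
Qed.

Let rr0 i : (n <= i)%N -> rr i = 0%N.
Proof. by move=> le; have [sy _] := fib; rewrite /rr nth_default ?sy. Qed.

Let row_lt i j : (j < rr i)%N -> (i < n)%N.
Proof. by move=> ji; rewrite ltnNge; apply: contraTN ji => /rr0 ->. Qed.

Let y_inj i j k : (j < rr i)%N -> (k < rr i)%N -> y i j = y i k -> j = k.
Proof.
move=> ji ki /eqP; have [_ /(_ i (row_lt ji))[sorted_i _]] := fib.
by rewrite nth_uniq ?(lt_sorted_uniq sorted_i) // => /eqP.
Qed.

Let yP i z : (i < n)%N -> z \in nth [::] ys i <-> ev g xs`_i z = 0.
Proof. by have [_ fibP] := fib => /fibP[_ /(_ z)]. Qed.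

Let y_root i j : (j < rr i)%N -> ev g xs`_i (y i j) = 0.
Proof. by move=> ji; apply/yP; [exact: row_lt ji|exact: mem_nth]. Qed.

Let delta_neq0 i j : (j < rr i)%N -> delta i j = (ev (dy g) xs`_i (y i j) != 0).
Proof.
by move=> ji; apply/idP/idP => [/(deltaP (row_lt ji) ji)/eqP|/eqP/(deltaP (row_lt ji) ji)].
Qed.

Let not_delta_critical i j : (j < rr i)%N -> ~~ delta i j -> critical g (xs`_i, y i j).
Proof. by move=> ji; rewrite delta_neq0 // negbK => /eqP dg; split => //=; exact: y_root. Qed.

Let regular_delta i j : regular_value g xs`_i -> (j < rr i)%N -> delta i j.
Proof.
move=> reg ji; apply: contraT => /(not_delta_critical ji) crit; case: reg.
by exists (xs`_i, y i j).
Qed.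

Let critical_neighbors i j : (j < rr i)%N -> ~~ delta i j ->
  [/\ (0 < i)%N, (i.+1 < n)%N, regular_value g xs`_i.-1 & regular_value g xs`_i.+1].
Proof.
move=> ji /(not_delta_critical ji) crit; have [_ _ partP] := part.
have [|i' [i'0 i'n Ei regp regn]] := partP xs`_i; first by exists (xs`_i, y i j).
have -> // : i = i'.
by apply: xs_inj => //; [exact: row_lt ji|exact: ltnW].
Qed.

Let delta0 j : (j < rr 0)%N -> delta 0 j.
Proof. by move=> j0; apply: contraT => /(critical_neighbors j0)[]. Qed.

Let delta_last i j : (n <= i.+1)%N -> (j < rr i)%N -> delta i j.
Proof.
by move=> le ji; apply: contraT => /(critical_neighbors ji)[_]; rewrite ltnNge le.
Qed.

Let delta_uniq i j k : (j < rr i)%N -> (k < rr i)%N ->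
  ~~ delta i j -> ~~ delta i k -> j = k.
Proof.
move=> ji ki /(not_delta_critical ji) cj /(not_delta_critical ki) ck.
have [_ _ sep] := gen; apply: (y_inj ji ki); apply: contrapT => ne.
by apply: (sep _ _ cj ck) => // -[].
Qed.

Let delta_prev i j k : (j < rr i.+1)%N -> ~~ delta i.+1 j -> (k < rr i)%N -> delta i k.
Proof. by move=> ji /(critical_neighbors ji)[_ _ reg _]; exact: regular_delta. Qed.

Let fiber_size i : (rr i <= tdeg g)%N.
Proof.
have [ltin|/rr0->] // := ltnP i n; apply: leq_trans (tdeg_size g).
have f0 := fiber_poly_neq0_of_general_position xs`_i.
have [_ /(_ i ltin)[sorted_i rootsE]] := fib.
have lt : (rr i < size (fiber_poly g xs`_i))%N.
  apply: max_poly_roots => //; last exact: lt_sorted_uniq.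
  by apply/allP => z /rootsE; rewrite /curve /= evE => /rootP.
have le : (size (fiber_poly g xs`_i) <= size g)%N by exact: size_poly.
by move: lt le; rewrite -/(rr i); lia.
Qed.

(** Both counts are indexed by the interval: [cL i] concerns its right endpoint, row [i.+1], and
    [cR i] its left endpoint, row [i]. *)
Let cL i j := #|[pred k : 'I_(rho i) | phi k xs`_i.+1 == y i.+1 j]|.
Let cR i j := #|[pred k : 'I_(rho i) | phi k xs`_i == y i j]|.

Let row_counts i : (i.+1 < n)%N ->
  [/\ (\sum_(j < rr i.+1) cL i j)%N = rho i, (\sum_(j < rr i) cR i j)%N = rho i,
      forall j, (j < rr i.+1)%N -> delta i.+1 j -> cL i j = 1%N &
      forall j, (j < rr i)%N -> delta i j -> cR i j = 1%N].
Proof.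
move=> ltin; have ltin' := ltnW ltin; have [br ends] := bran ltin.
have [_ fibP] := fib.
have lt_x : xs`_i < xs`_i.+1 by rewrite xs_lt.
have [cnta cntb] := unique_branch_endpoints lt_x br (fun k => let: And3 c _ _ := ends k in c).
split.
- apply: sum_half_branches => [|k]; first by have [/lt_sorted_uniq] := fibP _ ltin.
  by have [_ _ ck] := ends k; apply/yP.
- apply: sum_half_branches => [|k]; first by have [/lt_sorted_uniq] := fibP _ ltin'.
  by have [_ ck _] := ends k; apply/yP.
- by move=> j ji; rewrite delta_neq0 // => dj; apply: cntb => //; exact: y_root.
- by move=> j ji; rewrite delta_neq0 // => dj; apply: cnta => //; exact: y_root.
Qed.

Let sum1_row r (c : nat -> nat) : (forall j, (j < r)%N -> c j = 1%N) ->
  (\sum_(j < r) c j)%N = r.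
Proof. by move=> c1; rewrite (eq_bigr (fun=> 1%N)) ?sum1_card ?card_ord // => j _; exact: c1. Qed.

Let Lval i j := if (j < rr i)%N then (if i is i'.+1 then cL i' j else 1%N) else 0%N.
Let Rval i j := if (j < rr i)%N then (if (i.+1 < n)%N then cR i j else 1%N) else 0%N.

(** Next to a critical row, [rho] is counted twice: over the regular neighboring row it is the
    number of points, over the critical row it is the sought value plus the number of regular
    points. *)
Let LvalE i j : half_branch_value ys delta MatL i j = (Lval i j)%:Z.
Proof.
rewrite /half_branch_value /Lval -/(rr i); case: ltnP => // ji.
case: i ji => [|i] ji; first by rewrite delta0.
have ltin := row_lt ji; have [sumL sumR oneL oneR] := row_counts ltin.
case: ifPn => [dij|ndij]; first by rewrite oneL.
have Er : rr i = rho i.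
  by rewrite -sumR sum1_row // => k ki; rewrite oneR // (delta_prev ji ndij).
have := sum_one_exception ji ndij oneL (fun u ui nu => delta_uniq ui ji nu ndij).
rewrite sumL -Er /= -/(rr i) -/(rr i.+1) => ->.
by rewrite PoszD addrK.
Qed.

Let RvalE i j : half_branch_value ys delta MatR i j = (Rval i j)%:Z.
Proof.
rewrite /half_branch_value /Rval -/(rr i); case: ltnP => // ji.
case: (ltnP i.+1 n) => [ltin|le]; last by rewrite delta_last.
have [sumL sumR oneL oneR] := row_counts ltin.
case: ifPn => [dij|ndij]; first by rewrite oneR.
have [_ _ _ regn] := critical_neighbors ji ndij.
have Er : rr i.+1 = rho i.
  by rewrite -sumL sum1_row // => k ki; rewrite oneL // regular_delta.
have := sum_one_exception ji ndij oneR (fun u ui nu => delta_uniq ui ji nu ndij).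
rewrite sumR -Er /= -/(rr i) -/(rr i.+1) => ->.
by rewrite PoszD addrK.
Qed.

(** The constant 8 is 4 times 2: at most [4 * d] additions per critical row and at most [2 * d ^ 2]
    critical rows. *)
Lemma half_branch_prog_cost :
  (cost (run xs ys delta half_branch_prog) <= 8 * tdeg g ^ 3)%N.
Proof.
have [sys _] := fib; rewrite run_cost //.
set d := tdeg g; pose bad i := has (predC (delta i)) (iota 0 (rr i)).
have term (v : 'I_n) : (count (predC (delta v.+1)) (iota 0 (rr v.+1)) *
    (rr v + rr v.+2 + 2 * count (delta v.+1) (iota 0 (rr v.+1))) <= bad v.+1 * (4 * d))%N.
  apply: leq_mul.
    by apply: count_exception_le => j k; exact: delta_uniq.
  have := count_size (delta v.+1) (iota 0 (rr v.+1)); rewrite size_iota.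
  have := fiber_size v; have := fiber_size v.+1; have := fiber_size v.+2; rewrite -/d; lia.
apply: leq_trans (leq_sum _ (fun v _ => term v)) _.
rewrite -big_distrl /=.
(* These are distinct critical values, and all critical values lie in [xs], so [critical_bound]
   applies with [T] equal to [xs]. *)
pose zs := [seq xs`_v.+1 | v <- iota 0 n & bad v.+1].
have badP v : bad v.+1 -> (v.+1 < n)%N /\ critical_value g xs`_v.+1.
  move=> /hasP[j]; rewrite mem_iota add0n /= => jv nj; split; first exact: row_lt jv.
  by exists (xs`_v.+1, y v.+1 j) => //; exact: not_delta_critical.
have Ebad : (\sum_(v < n) bad v.+1)%N = size zs.
  rewrite size_map size_filter -sum1_count -[n in iota _ n]subn0.
  rewrite -[iota _ _]/(index_iota _ _) big_mkord [RHS]big_mkcond.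
  by apply: eq_bigr => v _; case: (bad v.+1).
have szs : (size zs <= 2 * ((sizeY g).-1 * (size g).-1))%N.
  have [_ _ partP] := part; apply: (critical_bound (T := xs)).
  - exact: fiber_poly_neq0_of_general_position.
  - move=> x /partP[i [_ ltin -> _ _]]; apply: mem_nth; exact: ltnW.
  - rewrite map_inj_in_uniq ?filter_uniq ?iota_uniq // => u v.
    rewrite !mem_filter => /andP[/badP[un _] _] /andP[/badP[vn _] _].
    by move=> /(xs_inj un vn)[].
  - by move=> x /mapP[v + ->]; rewrite mem_filter => /andP[/badP[]].
rewrite Ebad.
have := leq_mul (tdeg_sizeY g) (tdeg_size g); rewrite -/d => le.
rewrite !expnS expn0 muln1; nia.
Qed.

Lemma half_branch_prog_correct : exists ML MR : 'M[nat]_(size xs, tdeg g),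
  is_data g phi xs ys ML MR /\
  forall (i : 'I_(size xs)) (j : 'I_(tdeg g)),
    entries (run xs ys delta half_branch_prog) MatL i j = (ML i j)%:Z /\
    entries (run xs ys delta half_branch_prog) MatR i j = (MR i j)%:Z.
Proof.
have [sys _] := fib; have [_ n2 partP] := part.
exists (\matrix_(i, j) Lval i j), (\matrix_(i, j) Rval i j); split; last first.
  by move=> i j; rewrite !mxE !run_entries // LvalE RvalE.
split => // [i|i j]; first exact: fiber_size.
rewrite /= !mxE -[size (nth _ _ _)]/(rr i) /Lval /Rval; case: ifP => ji;
  rewrite [(_ < rr i)%N]ji //.
have dyn : delta i j -> ev (dy g) xs`_i (y i j) != 0 by rewrite delta_neq0.
split.
  (* Only the first row needs an argument: critical values are partition points, so none lies to its
     left and the outer branches exist. *)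
  rewrite /half_left; case: i ji dyn => -[|i] /= ltin ji dyn //.
  apply: end_half_left_regular => // [t lt_t /partP[i [i0 ltSin Et _ _]]||].
  - have : (xs`_i < xs`_0) by rewrite -Et.
    by rewrite xs_lt // ltnW.
  - exact: y_root.
  - exact/dyn/delta0.
rewrite /half_right -/n; case: ltnP => // le.
apply: end_half_right_regular => // [t lt_t /partP[i' [i0 ltSin Et _ _]]||].
- have : (xs`_i < xs`_i') by rewrite -Et.
  rewrite xs_lt ?(ltnW ltSin) // => lt.
  by have := leq_trans le lt; rewrite leqNgt (ltnW ltSin).
- exact: y_root.
- by apply/dyn/delta_last.
Qed.

End Assembly.

Theorem theorem8 (R : realType) :
  exists (p : prog) (C : nat),
  forall (d : nat) (g : {poly {poly R}}) (xs : seq R) (ys : seq (seq R))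
    (rho : nat -> nat) (phi : forall i : nat, 'I_(rho i) -> R -> R)
    (delta : nat -> nat -> bool),
    tdeg g = d ->
    general_position g ->
    good_partition g xs ->
    fibers g xs ys ->
    branch_system g xs phi ->
    (forall i j : nat, (i < size xs)%N -> (j < size (nth [::] ys i))%N ->
       delta i j <-> ev (dy g) xs`_i (nth [::] ys i)`_j <> 0) ->
    let st := run xs ys delta p in
    exists ML MR : 'M[nat]_(size xs, tdeg g),
      [/\ is_data g phi xs ys ML MR,
          forall (i : 'I_(size xs)) (j : 'I_(tdeg g)),
            entries st MatL i j = (ML i j)%:Z /\ entries st MatR i j = (MR i j)%:Z &
          (cost st <= C * d ^ 3)%N].
Proof.
exists half_branch_prog, 8%N => d g xs ys rho phi delta <- gen part fib bran deltaP /=.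
have [ML [MR [data entriesE]]] := half_branch_prog_correct gen part fib bran deltaP.
exists ML, MR; split=> //; exact: half_branch_prog_cost gen part fib deltaP.
Qed.
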